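(* Let $\Delta\geq 3$ be an integer. Then there exists a value $\epsilon=\epsilon(\Delta)>0$ for which the following holds. If $G$ is a $3$-connected non-regular graph of maximum degree $\Delta$, then $G$ is almost $\epsilon$-flexibly $(\Delta-1)$-degenerate.
   Context: Graphs are finite and simple. A graph is non-regular if it contains two vertices of different degrees. For $\epsilon>0$ and an integer $k\ge1$, a graph $G$ is almost $\epsilon$-flexibly $k$-degenerate if the following holds for every vertex subset $R\subseteq V(G)$, except that if $G$ contains exactly one vertex $w$ of degree at most $k$, then the set $R=\{w\}$ is excluded: there exists a linear ordering $D$ of $V(G)$ such that (i) for each vertex $v\in V(G)$, at most $k$ neighbors of $v$ appear before $v$ in $D$; and (ii) there exist at least $\epsilon|R|$ vertices $r\in R$ for which no neighbor of $r$ appears before $r$ in $D$. *)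

(* Defs.v *)
From mathcomp Require Import all_boot all_order all_algebra.
From mathcomp Require Import reals.

Set Implicit Arguments.
Unset Strict Implicit.
Unset Printing Implicit Defensive.

Import Order.TTheory GRing.Theory Num.Theory.

Record sgraph := SGraph {
  vertex :> finType;
  adj : rel vertex;
  adj_sym : symmetric adj;
  adj_irrefl : irreflexive adj
}.

Section Graphs.
Variable G : sgraph.

Definition neighbors (v : G) : {set G} := [set u | adj v u].

Definition degree (v : G) : nat := #|neighbors v|.

Definition max_degree : nat := \max_(v : G) degree v.

Definition nonregular : Prop := exists u v : G, degree u <> degree v.

Definition induced_adj (S : {set G}) : rel G :=
  [rel x y | [&& x \in S, y \in S & adj x y]].

Definition induced_connected (S : {set G}) : Prop :=
  S != set0 /\ {in S &, forall x y, connect (induced_adj S) x y}.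

Definition vertex_connected (k : nat) : Prop :=
  k < #|G| /\ forall X : {set G}, #|X| < k -> induced_connected (~: X).

(* A linear ordering is the list of all vertices in increasing order. *)
Definition linear_ordering (D : seq G) : Prop :=
  uniq D /\ forall v : G, v \in D.

Definition earlier_neighbors (D : seq G) (v : G) : {set G} :=
  [set u in neighbors v | index u D < index v D].

Definition almost_flexibly_degenerate
    (R : realType) (epsilon : R) (k : nat) : Prop :=
  forall Q : {set G},
    ~ (exists w : G, [set v : G | degree v <= k] = [set w] /\ Q = [set w]) ->
    exists D : seq G,
      [/\ linear_ordering D,
          forall v : G, #|earlier_neighbors D v| <= k
        & (epsilon * #|Q|%:R
             <= #|[set r in Q | earlier_neighbors D r == set0]|%:R)%R].

End Graphs.

(* Main.v *)
(** Vertices that precede all their neighbours may as well form an independent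
    initial segment [S] of the ordering; the remaining vertices can then be
    listed towards a vertex [w] of degree less than [Delta] as soon as [G - S]
    is connected and contains [w].  So it suffices to find a set [S] of linear
    size inside an independent subset of [Q :\ w] such that [G - S] is
    connected.

    Start with [U] independent.  Each [r] in [U] touches at most [Delta]
    components of [G - U], and moving [r] out of [U] merges the [d] components
    it touches into one.  Suppose that all vertices of [U] touch at most [j]
    components.  Move out, as long as possible, vertices touching exactly [j]
    components: this leaves [U'] whose vertices touch at most [j - 1].  If
    [G - U] is disconnected, 3-connectivity makes each of its [c] components
    touch at least three vertices of [U], so that
    [3 (j - 1) (|U| - |U'|) < 3 c <= j |U|] and hence [|U| <= 3 |U'|].
    Descending to [j = 1] costs a factor [3 ^ (Delta - 1)], and there [G - U]
    is connected because [G] is. *)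

Require Import Defs.
From mathcomp Require Import all_boot all_order all_algebra.
From mathcomp Require Import reals.
From mathcomp Require Import zify.

Set Implicit Arguments.
Unset Strict Implicit.
Unset Printing Implicit Defensive.

(** On [A], [g] factors through [f], so sending each value of [g] to the [f]-value of a chosen
    preimage is injective. [h] takes values in an option type because [rT] offers no default
    element. *)
Lemma card_imset_coarser (aT rT sT : finType) (f : aT -> rT) (g : aT -> sT)
    (A : {set aT}) :
  {in A &, forall x y, f x = f y -> g x = g y} -> #|g @: A| <= #|f @: A|.
Proof.
move=> fg.
pose h (b : sT) := omap f [pick x in A | g x == b].
have hP x : x \in A -> exists2 y, y \in A & g y = g x /\ h (g x) = Some (f y).
  move=> xA; rewrite /h; case: pickP => [y /andP[yA /eqP gyx]|/(_ x)].
    by exists y.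
  by rewrite xA eqxx.
have h_inj : {in g @: A &, injective h}.
  move=> _ _ /imsetP[x xA ->] /imsetP[y yA ->].
  have [x' x'A [<- ->]] := hP x xA; have [y' y'A [<- ->]] := hP y yA.
  by case=> /fg; apply.
rewrite -(card_in_imset h_inj) -(card_imset (f @: A) (@Some_inj _)).
apply/subset_leq_card/subsetP => _ /imsetP[_ /imsetP[x xA ->] ->].
have [y yA [_ ->]] := hP x xA.
by apply/imset_f/imset_f.
Qed.

(** * Components of [G - U] and their merging when [U] shrinks *)

Section Components.
Variable G : sgraph.
Implicit Types (U I : {set G}) (r x y : G).

(** For [x] in [U] this is the singleton of [x], since no edge of [induced_adj (~: U)] meets [U]. *)
Definition component U x : {set G} :=
  [set y | connect (induced_adj (~: U)) x y].

Definition components U : {set {set G}} := component U @: ~: U.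

Definition touched U r : {set {set G}} := component U @: neighbors r.

Definition independent U := [forall x in U, forall y in U, ~~ adj x y].

Lemma independentP U :
  reflect {in U &, forall x y, ~~ adj x y} (independent U).
Proof.
apply: (iffP forall_inP) => [h x y xU yU|h x xU].
  by move/forall_inP: (h x xU); apply.
by apply/forall_inP => y; apply: h.
Qed.

Lemma independentS U I : I \subset U -> independent U -> independent I.
Proof.
move=> /subsetP sIU /independentP indU; apply/independentP => x y xI yI.
by apply: indU; apply: sIU.
Qed.

Lemma connect_induced_sym (X : {set G}) : connect_sym (induced_adj X).
Proof.
by apply: sym_connect_sym => x y; rewrite /induced_adj /= adj_sym andbCA.
Qed.

Lemma mem_component U x : x \in component U x.
Proof. by rewrite inE. Qed.

Lemma component_eqP U x y :
  reflect (component U x = component U y)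
          (connect (induced_adj (~: U)) x y).
Proof.
apply: (iffP idP) => [xy|exy]; last first.
  by have := mem_component U y; rewrite -exy inE.
apply/setP => z; rewrite !inE.
exact: (same_connect (@connect_induced_sym _)).
Qed.

Lemma adj_component U x y :
  x \notin U -> y \notin U -> adj x y -> component U x = component U y.
Proof.
move=> xU yU xy; apply/component_eqP/connect1.
by rewrite /induced_adj /= !inE xU yU.
Qed.

Lemma component_closed U (K : {set G}) x y :
  {in K, forall z t, t \notin U -> adj z t -> t \in K} ->
  x \in K -> y \in component U x -> y \in K.
Proof.
move=> clK xK; rewrite inE => /connectP[p p_path ->] {y}.
elim: p x xK p_path => //= y p IHp x xK /andP[/and3P[_ yU xy]].
by apply: IHp; apply: clK xy => //; move: yU; rewrite inE.
Qed.

Lemma sub_component U x : x \notin U -> component U x \subset ~: U.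
Proof.
move=> xU; apply/subsetP => y; apply: component_closed; rewrite ?inE //.
by move=> z _ t tU _; rewrite inE.
Qed.

Lemma component_mono U I x y : I \subset U ->
  component U x = component U y -> component I x = component I y.
Proof.
move=> /subsetP sIU /component_eqP xy; apply/component_eqP.
apply: connect_sub xy => a b /= /and3P[aU bU ab]; apply: connect1.
move: aU bU; rewrite /induced_adj /= !inE ab andbT => aU bU.
by apply/andP; split; [apply: contra aU|apply: contra bU]; apply: sIU.
Qed.

Lemma card_touched_mono U I r : I \subset U -> #|touched I r| <= #|touched U r|.
Proof.
by move=> sIU; apply: card_imset_coarser => x y _ _; apply: component_mono.
Qed.

Lemma touched_sub U r :
  independent U -> r \in U -> touched U r \subset components U.
Proof.
move=> /independentP indU rU; apply: imsetS; apply/subsetP => x.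
by rewrite !inE => rx; apply: contraL rx => xU; apply: indU.
Qed.

(** The only new edges join [r] to its neighbours, all outside [U] by independence. Hence the
    touched components fuse around [r], while an untouched one has no new way out. *)
Lemma component_restore U r x : independent U -> r \in U -> x \notin U ->
  component (U :\ r) x =
    if component U x \in touched U r then component (U :\ r) r
    else component U x.
Proof.
move=> indU rU xU.
have nbrU y : adj r y -> y \notin U.
  move=> ry; apply: contraL ry => yU.
  by move/independentP: indU; apply.
have notUr y : y \notin U -> y \notin U :\ r.
  by rewrite !inE negb_and => ->; rewrite orbT.
case: ifP => [/imsetP[y]|xr].
  rewrite inE => ry exy.
  rewrite (component_mono (subD1set U r) exy); apply/esym/adj_component => //.
    by rewrite !inE eqxx.
  exact/notUr/nbrU.
apply/setP => z; apply/idP/idP => [|xz]; last first.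
  have /component_eqP : component (U :\ r) x = component (U :\ r) z.
    apply: (component_mono (subD1set U r)).
    by apply/component_eqP; move: xz; rewrite inE.
  by rewrite inE.
apply: component_closed; last exact: mem_component.
move=> a xa b bU ab.
have aU : a \notin U by have /subsetP/(_ a xa) := sub_component xU; rewrite inE.
have exa : component U x = component U a.
  by apply/component_eqP; move: xa; rewrite inE.
have br : b != r.
  apply/eqP => br; move: ab; rewrite br adj_sym => ra; move/negP: xr; apply.
  by rewrite exa; apply: imset_f; rewrite inE.
have bU' : b \notin U by move: bU; rewrite !inE br.
by rewrite exa (adj_component aU bU' ab) mem_component.
Qed.

Lemma components_restore U r : independent U -> r \in U -> neighbors r != set0 ->
  components (U :\ r) =
    component (U :\ r) r |: (components U :\: touched U r).
Proof.
move=> indU rU r_nbr.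
have rUr : r \in ~: (U :\ r) by rewrite !inE eqxx.
apply/setP => K; apply/idP/idP.
  move=> /imsetP[x xU ->].
  have [->|xr] := eqVneq x r; first by rewrite setU11.
  have {}xU : x \notin U by move: xU; rewrite !inE xr.
  rewrite component_restore //; case: ifP => xt; first by rewrite setU11.
  by rewrite !inE xt imset_f ?orbT // inE.
rewrite 2!inE => /orP[/eqP->|]; first exact: imset_f.
rewrite inE => /andP[Kt /imsetP[x xU eK]].
move: Kt xU; rewrite eK !inE => Kt xU.
have := component_restore indU rU xU; rewrite (negbTE Kt) => <-.
by apply: imset_f; rewrite !inE negb_and xU orbT.
Qed.

(** The touched components are traded for a single one; the additive form avoids truncated
    subtraction. *)
Lemma card_components_restore U r :
  independent U -> r \in U -> neighbors r != set0 ->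
  #|components (U :\ r)| + #|touched U r| = #|components U|.+1.
Proof.
move=> indU rU r_nbr; rewrite components_restore // cardsU1.
have -> : component (U :\ r) r \notin components U :\: touched U r.
  rewrite inE negb_and; apply/orP; right; apply/imsetP => -[x].
  rewrite inE => xU er.
  have := mem_component (U :\ r) r; rewrite er.
  by move/(subsetP (sub_component xU)); rewrite inE rU.
have := subset_leq_card (touched_sub indU rU).
rewrite cardsD (setIidPr (touched_sub indU rU)); lia.
Qed.

Lemma components_le1P U x y : #|components U| <= 1 ->
  x \notin U -> y \notin U -> connect (induced_adj (~: U)) x y.
Proof.
move=> /card_le1_eqP c1 xU yU; apply/component_eqP.
by apply: c1; rewrite imset_f // inE.
Qed.

(** For an inclusion-maximal independent [I], the closed neighbourhoods of its vertices cover [U],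
    and each has at most [(max_degree G).+1] elements. *)
Lemma exists_independent U : exists I : {set G},
  [/\ I \subset U, independent I & #|U| <= (max_degree G).+1 * #|I|].
Proof.
have : exists I : {set G}, (I \subset U) && independent I.
  by exists set0; rewrite sub0set; apply/independentP => x y; rewrite inE.
case/ex_maxset => I /maxsetP[/andP[sIU indI] maxI].
exists I; split=> //.
have cover : U \subset \bigcup_(x in I) (x |: neighbors x).
  apply/subsetP => y yU; apply: contraT => yN.
  have yNI x : x \in I -> (y != x) && ~~ adj x y.
    move=> xI; rewrite -negb_or; apply: contra yN => yx.
    by apply/bigcupP; exists x => //; rewrite !inE.
  suff /maxI : (y |: I \subset U) && independent (y |: I).
    move=> /(_ (subsetUr _ _))/setP/(_ y); rewrite setU11 => /esym/yNI.
    by rewrite eqxx.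
  rewrite subUset sub1set yU sIU /=; apply/independentP => a b.
  rewrite !inE => /orP[/eqP->|aI] /orP[/eqP->|bI].
  - by rewrite adj_irrefl.
  - by rewrite adj_sym; case/andP: (yNI b bI).
  - by case/andP: (yNI a aI).
  - by move/independentP: indI; apply.
apply: leq_trans (subset_leq_card cover) _.
rewrite mulnC -sum_nat_const.
elim/big_ind2: _ => [|A m B n leA leB|x _]; first by rewrite cards0.
  by apply: leq_trans (leq_card_setU _ _) _; apply: leq_add.
rewrite cardsU1 -add1n; apply: leq_add; first exact: leq_b1.
exact: (leq_bigmax (F := fun v : G => degree v)).
Qed.

End Components.

(** * Counting components in 3-connected graphs *)

Section ThreeConnected.
Variables (G : sgraph) (G3 : vertex_connected G 3).
Implicit Types (U I : {set G}).

Lemma neighbors_neq0 (x : G) : neighbors x != set0.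
Proof.
case: G3 => card3 conn; have := conn set0; rewrite cards0 => -[] // _.
rewrite setC0 => cG.
have /card_gt0P[y] : 0 < #|[set~ x]| by rewrite cardsC1; lia.
rewrite !inE => yx; have := cG x y (in_setT _) (in_setT _).
case/connectP=> -[/= _ eyx|z p /=]; first by rewrite eyx eqxx in yx.
by case/andP => /and3P[_ _ xz] _ _; apply/set0Pn; exists z; rewrite inE.
Qed.

(** A path can leave [K] only through the set [N] of vertices of [U] touching it. If [N] had at most
    two elements, [G - N] would be connected, and [K] would be the only component of [G - U]. *)
Lemma three_le_boundary U (K : {set G}) : 1 < #|components U| ->
  K \in components U -> 2 < #|[set r in U | K \in touched U r]|.
Proof.
move=> c2 /imsetP[x xU eK]; set N := [set r in U | _].
have xU' : x \notin U by rewrite inE in xU.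
rewrite ltnNge; apply/negP => N2.
case: G3 => _ /(_ N); rewrite ltnS => /(_ N2)[_ cN].
have sNU y : y \notin U -> y \in ~: N by rewrite !inE => /negbTE->.
have clK y : y \in component N x -> y \in component U x.
  apply: component_closed; last exact: mem_component.
  move=> z xz t tN zt.
  have zU : z \notin U by have /subsetP/(_ z xz) := sub_component xU'; rewrite inE.
  have exz : component U x = component U z.
    by apply/component_eqP; move: xz; rewrite inE.
  have tU : t \notin U.
    apply: contra tN => tU; rewrite inE tU eK exz; apply: imset_f.
    by rewrite inE adj_sym.
  by rewrite exz (adj_component zU tU zt) mem_component.
suff : #|components U| <= 1 by rewrite leqNgt c2.
rewrite -(cards1 (component U x)); apply/subset_leq_card/subsetP.
move=> _ /imsetP[y yU ->]; rewrite inE in yU.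
have /clK : y \in component N x by rewrite inE; apply: cN; apply: sNU.
by rewrite inE => /component_eqP->; rewrite set11.
Qed.

(** Double counting of the pairs of a vertex of [U] and a component that it touches. *)
Lemma sum_touched U : independent U -> 1 < #|components U| ->
  3 * #|components U| <= \sum_(r in U) #|touched U r|.
Proof.
move=> indU c2.
have -> : \sum_(r in U) #|touched U r| =
          \sum_(K in components U) #|[set r in U | K \in touched U r]|.
  transitivity (\sum_(r in U) \sum_(K in components U) (K \in touched U r)).
    apply: eq_bigr => r rU; rewrite -sum1_card big_mkcond [RHS]big_mkcond /=.
    apply: eq_bigr => K _; case: ifP => [Kr|_]; last by case: ifP.
    by rewrite (subsetP (touched_sub indU rU)).
  rewrite exchange_big; apply: eq_bigr => K _.
  rewrite -sum1_card [RHS]big_mkcond [LHS]big_mkcond /=; apply: eq_bigr => r _.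
  by rewrite inE; case: (r \in U) => //=; case: (K \in _).
rewrite mulnC -sum_nat_const; apply: leq_sum => K KU.
exact: three_le_boundary.
Qed.

(** Restoring a vertex that touches at most one component never lowers the number of components, and
    once all of [U] is restored, [G] itself is connected. *)
Lemma components_touched_le1 U : independent U ->
  {in U, forall r, #|touched U r| <= 1} -> #|components U| <= 1.
Proof.
move: {2}#|U| (erefl #|U|) => n; elim: n U => [|n IHn] U cU indU t1.
  move/eqP: cU; rewrite cards_eq0 => /eqP->.
  case: G3 => _ /(_ set0); rewrite cards0 => -[] // _ cG.
  apply/card_le1_eqP => _ _ /imsetP[x xT ->] /imsetP[y yT ->].
  by apply/component_eqP/cG.
have /card_gt0P[r rU] : 0 < #|U| by rewrite cU.
have := card_components_restore indU rU (neighbors_neq0 r).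
have : #|components (U :\ r)| <= 1.
  apply: IHn; first by rewrite (cardsD1 r) rU in cU; case: cU.
    exact: independentS (subD1set _ _) indU.
  move=> s; rewrite inE => /andP[_ sU].
  exact: leq_trans (card_touched_mono _ (subD1set _ _)) (t1 s sU).
have := t1 r rU; lia.
Qed.

Lemma exists_touched_lt U j : independent U -> 1 < #|components U| ->
  {in U, forall r, #|touched U r| <= j.+2} ->
  exists I : {set G}, [/\ I \subset U, #|U| <= 3 * #|I|
    & {in I, forall r, #|touched I r| <= j.+1}].
Proof.
move=> indU c2 tU.
(* Instead of a sequence of removals, [P] keeps only its numerical effect: each vertex moved out
   costs at least [j.+1] components. A minimal [I] is one where the process has stopped. *)
pose P (I : {set G}) := (I \subset U) &&
  (#|components I| + j.+1 * (#|U| - #|I|) <= #|components U|).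
have : exists I, P I by exists U; rewrite /P subxx subnn muln0 addn0 leqnn.
case/ex_minset => I /minsetP[/andP[sIU cI] minI].
have leIU := subset_leq_card sIU.
exists I; split=> // [|r rI].
  have c3 : 3 * #|components U| <= j.+2 * #|U|.
    apply: leq_trans (sum_touched indU c2) _.
    by rewrite mulnC -sum_nat_const; apply: leq_sum.
  (* Combining [cI] and [c3] gives [(2 * j + 1) * #|U| <= 3 * (j + 1) * #|I|], and
     [j + 1 <= 2 * j + 1]. *)
  nia.
have := leq_trans (card_touched_mono r sIU) (tU r (subsetP sIU r rI)).
(* A vertex still touching [j.+2] components could be moved out as well, against minimality. *)
rewrite leq_eqVlt => /orP[/eqP tr|//].
have cr := card_components_restore (independentS sIU indU) rI (neighbors_neq0 r).
have cardI : #|I| = #|I :\ r|.+1 by rewrite (cardsD1 r) rI.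
suff /minI/(_ (subD1set I r)) eI : P (I :\ r).
  by move: cardI; rewrite eI; lia.
rewrite /P (subset_trans (subD1set _ _) sIU) andTb.
have -> : #|U| - #|I :\ r| = (#|U| - #|I|).+1 by lia.
rewrite mulnS; lia.
Qed.

Lemma exists_connected_removal j U : independent U ->
  {in U, forall r, #|touched U r| <= j.+1} ->
  exists S : {set G},
    [/\ S \subset U, #|components S| <= 1 & #|U| <= 3 ^ j * #|S|].
Proof.
elim: j U => [|j IHj] U indU tU.
  by exists U; rewrite mul1n; split=> //; apply: components_touched_le1.
have [c1|c2] := leqP #|components U| 1.
  by exists U; split=> //; rewrite leq_pmull // expn_gt0.
have [I [sIU leUI tI]] := exists_touched_lt indU c2 tU.
have [S [sSI c1 leIS]] := IHj I (independentS sIU indU) tI.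
exists S; split=> //; first exact: subset_trans sSI sIU.
by rewrite expnS; nia.
Qed.

End ThreeConnected.

(** * Degenerate orderings from connected complements *)

Section Orderings.
Variable G : sgraph.
Implicit Types (S : {set G}) (v w x y : G) (s : seq G).

Lemma exists_ordering_towards S w : w \in S ->
  {in S, forall x, connect (induced_adj S) w x} ->
  exists s, [/\ uniq s, s =i S
    & {in S, forall x, x != w -> exists2 y, adj x y
       & (y \in S) && (index x s < index y s)}].
Proof.
move=> wS conn.
pose good s := [/\ uniq s, {subset s <= S}, w \in s
  & {in s, forall x, x != w ->
       exists2 y, adj x y & (y \in s) && (index x s < index y s)}].
(* The list is grown from its end [w] by consing vertices adjacent to it. *)
have grow n : n < #|S| -> exists2 s, good s & size s = n.+1.
  elim: n => [_|n IHn ltnS].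
    exists [:: w] => //; split=> //=; rewrite ?mem_head //.
      by move=> x; rewrite inE => /eqP->.
    by move=> x; rewrite inE => /eqP->; rewrite eqxx.
  have [s [us sS ws sP] szs] := IHn (ltnW ltnS).
  have [x [y [xS xs ys xy]]] :
      exists x y, [/\ x \in S, x \notin s, y \in s & adj x y].
    have [/exists_inP[x xS /exists_inP[y ys /andP[xs xy]]]|N] := boolP
        [exists x in S, [exists y in s, (x \notin s) && adj x y]].
      by exists x, y.
    have last_s p a : a \in s -> path (induced_adj S) a p -> last a p \in s.
      elim: p a => //= b p IHp a as_ /andP[/and3P[_ bS ab]].
      apply: IHp; apply: contraR N => bs.
      apply/exists_inP; exists b => //; apply/exists_inP; exists a => //.
      by rewrite bs adj_sym.
    have : #|S| <= size s.
      apply: leq_trans (card_size s); apply/subset_leq_card/subsetP.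
      by move=> z /conn/connectP[p p_path ->]; apply: last_s.
    by rewrite szs leqNgt ltnS.
  exists (x :: s); last by rewrite /= szs.
  split=> [|z|| z].
  - by rewrite /= xs.
  - by rewrite inE => /orP[/eqP->|/sS].
  - by rewrite inE ws orbT.
  rewrite inE => /orP[/eqP-> _|zs zw].
    exists y => //; rewrite inE ys orbT /= eqxx.
    by case: eqP => // xy'; rewrite xy' ys in xs.
  have [t zt /andP[ts lt]] := sP z zs zw; exists t => //.
  rewrite inE ts orbT /=.
  case: eqP => [xz|_]; first by rewrite xz zs in xs.
  by case: eqP => [xt|_]; first by rewrite xt ts in xs.
have S0 : 0 < #|S| by apply/card_gt0P; exists w.
have [|s [us sS ws sP] szs] := grow #|S|.-1; first by rewrite prednK.
have eS : s =i S.
  apply/subset_cardP; last exact/subsetP.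
  by rewrite (card_uniqP us) szs prednK.
exists s; split=> // x; rewrite -eS => xs xw.
by have [y xy] := sP x xs xw; rewrite eS; exists y.
Qed.

(** List [S] first, then its complement towards [w]. Every vertex except [w] has a later neighbour,
    hence at most [k] earlier ones; [w] has at most [k] neighbours anyway. *)
Lemma exists_degenerate_ordering S w k :
  independent S -> #|components S| <= 1 -> w \notin S ->
  degree w <= k -> (forall v, degree v <= k.+1) ->
  {in S, forall v, 0 < degree v} ->
  exists D, [/\ linear_ordering D, forall v, #|earlier_neighbors D v| <= k
    & {in S, forall v, earlier_neighbors D v = set0}].
Proof.
move=> /independentP indS c1 wS wk degk degS.
have [||s [us eS sP]] := @exists_ordering_towards (~: S) w.
- by rewrite inE.
- by move=> x; rewrite inE => xS; apply: components_le1P.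
have memD v : v \in enum S ++ s by rewrite mem_cat mem_enum eS inE orbN.
have index_later v u : v \in S -> u \notin S ->
    index v (enum S ++ s) < index u (enum S ++ s).
  move=> vS uS; rewrite !index_cat !mem_enum vS (negbTE uS).
  by rewrite ltn_addr // index_mem mem_enum.
have later v : v != w -> exists2 y, adj v y &
    index v (enum S ++ s) < index y (enum S ++ s).
  move=> vw; have [vS|vS] := boolP (v \in S).
    have /card_gt0P[y] := degS v vS; rewrite inE => vy.
    exists y => //; apply: index_later => //.
    by apply: contraL vy => /(indS _ _ vS).
  have vS' : v \in ~: S by rewrite inE.
  have [y vy /andP[yS lt]] := sP v vS' vw; exists y => //.
  rewrite inE in yS.
  by rewrite !index_cat !mem_enum (negbTE vS) (negbTE yS) ltn_add2l.
exists (enum S ++ s); split.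
- split=> //; rewrite cat_uniq enum_uniq us andbT /=.
  by apply/hasPn => x; rewrite eS inE mem_enum.
- move=> v; have [->|vw] := eqVneq v w.
    apply: leq_trans wk; apply/subset_leq_card/subsetP => x.
    by rewrite inE => /andP[].
  have [y vy lt] := later v vw.
  rewrite -ltnS; apply: leq_trans (degk v); apply/proper_card/properP; split.
    by apply/subsetP => x; rewrite inE => /andP[].
  by exists y; rewrite !inE vy // -leqNgt ltnW.
move=> v vS; apply/setP => u; rewrite !inE.
apply/negP => /andP[vu]; apply/negP; rewrite -leqNgt ltnW // index_later //.
by apply: contraL vu => /(indS _ _ vS).
Qed.

End Orderings.

Theorem corollary5p7 (R : realType) (Delta : nat) (hDelta : 3 <= Delta) :
  exists epsilon : R, (0 < epsilon)%R /\
    forall G : sgraph,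
      vertex_connected G 3 -> nonregular G -> max_degree G = Delta ->
      almost_flexibly_degenerate G epsilon (Delta - 1).
Proof.
(* The factors are the losses from deleting [w] from [Q], from passing to an independent set, and
   from lowering the number of touched components from [Delta] to 1. *)
pose C := 2 * (Delta.+1 * 3 ^ Delta.-1).
have C0 : 0 < C by rewrite !muln_gt0 expn_gt0.
exists (C%:R^-1)%R; split; first by rewrite Num.Theory.invr_gt0 Num.Theory.ltr0n.
move=> G G3 Gnr GD Q Qw; rewrite subn1 in Qw *.
have degD (v : G) : degree v <= Delta.
  by rewrite -GD; apply: (leq_bigmax (F := fun v : G => degree v)).
pose L := [set v : G | degree v <= Delta.-1].
have [w0 w0L] : exists w, w \in L.
  case: Gnr => u [v uv]; have := degD u; have := degD v.
  have [du|du] := leqP (degree u) Delta.-1; first by exists u; rewrite inE.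
  by exists v; rewrite inE; lia.
(* Deleting [w0] at worst halves [Q], unless [Q] is [[set w0]]; then another vertex of [L] serves,
   and the excluded case is exactly the one where there is none. *)
have [w wL leQ] : exists2 w, w \in L & #|Q| <= 2 * #|Q :\ w|.
  have [eQ|Qw0] := boolP (Q == [set w0]); last first.
    exists w0 => //; have := cardsD1 w0 Q.
    case: (boolP (w0 \in Q)) => w0Q; last by lia.
    have : Q :\ w0 != set0.
      by rewrite setD_eq0 subset1 negb_or Qw0 /=; apply/set0Pn; exists w0.
    rewrite -card_gt0; lia.
  have [eL|/set0Pn[w]] := boolP (L :\ w0 == set0).
    case: Qw; exists w0; split; last exact/eqP.
    apply/setP => x; move/eqP/setP: eL => /(_ x); rewrite !inE.
    by case: eqP => // ->; move: w0L; rewrite inE => ->.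
  rewrite !inE => /andP[ww0 wL]; exists w; first by rewrite inE.
  by rewrite (eqP eQ) (cardsD1 w) !inE (negbTE ww0); lia.
have [I [sIQ indI leI]] := exists_independent (Q :\ w).
have [|S [sSI c1 leS]] := @exists_connected_removal _ G3 Delta.-1 I indI.
  move=> r _; apply: leq_trans (leq_imset_card _ _) _.
  by rewrite prednK ?degD //; lia.
have sSQ := subset_trans sSI sIQ.
have [||||||D [linD degenD D0]] := @exists_degenerate_ordering G S w Delta.-1.
- exact: independentS indI.
- exact: c1.
- by apply/negP => /(subsetP sSQ); rewrite !inE eqxx.
- by move: wL; rewrite inE.
- by move=> v; rewrite prednK ?degD //; lia.
- by move=> v _; rewrite card_gt0 neighbors_neq0.
exists D; split=> //.
rewrite Num.Theory.ler_pdivrMl ?Num.Theory.ltr0n // -GRing.Theory.natrM.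
rewrite Num.Theory.ler_nat.
have sS : S \subset [set r in Q | earlier_neighbors D r == set0].
  apply/subsetP => r rS; rewrite inE D0 // eqxx andbT.
  by have := subsetP sSQ r rS; rewrite inE => /andP[].
apply: leq_trans leQ _; rewrite -mulnA leq_pmul2l // -mulnA.
apply: leq_trans leI _; rewrite GD leq_pmul2l //.
by apply: leq_trans leS _; rewrite leq_pmul2l ?expn_gt0 // subset_leq_card.
Qed.
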